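(* Let $W,T,V$ be pairwise disjoint finite sets and let $\mathcal{V}_{WTV},\mathcal{V}_V,\mathcal{V}_T$ be vector spaces over a field $\mathbb{F}$ on $W\uplus T\uplus V$, $V$, $T$ respectively. Then $\{\mathcal{V}_{WTV},\mathcal{V}_T\oplus\mathcal{V}_V\}$ is rigid 1. iff $\{\mathcal{V}_{WTV},\mathcal{V}_V\}$ and $\{\mathcal{V}_{WTV}\leftrightarrow\mathcal{V}_V,\mathcal{V}_T\}$ are rigid; 2. iff $\{\mathcal{V}_{WTV},\mathcal{V}_V\}$ is rigid, $\{\mathcal{V}_{WTV}\cap\mathcal{V}_V,\mathcal{V}_T\}$ satisfies the full sum property and $\{\mathcal{V}_{WTV}+\mathcal{V}_V,\mathcal{V}_T\}$ satisfies the zero intersection property; 3. iff $\{\mathcal{V}_{WTV},\mathcal{V}_V\}$, $\{\mathcal{V}_{WTV}\cap\mathcal{V}_V,\mathcal{V}_T\}$ and $\{\mathcal{V}_{WTV}+\mathcal{V}_V,\mathcal{V}_T\}$ are rigid.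
   Context: A vector on a finite set $X$ over $\mathbb{F}$ is a function $X\to\mathbb{F}$; for disjoint $X,Y$ vectors on $X\uplus Y$ are written $(f_X,f_Y)$ and spaces on $X\uplus Y$ carry the subscript $XY$. $\mathcal{F}_X$ is the space of all vectors on $X$, $\mathbf{0}_X$ the zero space, and $\mathcal{V}_X\oplus\mathcal{V}_Y=\{(f_X,g_Y):f_X\in\mathcal{V}_X,g_Y\in\mathcal{V}_Y\}$. For pairwise disjoint $S,P,Q$ (any possibly empty) and vector spaces $\mathcal{V}_{SP},\mathcal{V}_{PQ}$: $\mathcal{V}_{SP}\circ S=\{f_S:(f_S,f_P)\in\mathcal{V}_{SP}\text{ for some }f_P\}$; $\mathcal{V}_{SP}\times S=\{f_S:(f_S,0_P)\in\mathcal{V}_{SP}\}$; $\mathcal{V}_{SP}+\mathcal{V}_{PQ}=(\mathcal{V}_{SP}\oplus\mathbf{0}_Q)+(\mathbf{0}_S\oplus\mathcal{V}_{PQ})$; $\mathcal{V}_{SP}\cap\mathcal{V}_{PQ}=(\mathcal{V}_{SP}\oplus\mathcal{F}_Q)\cap(\mathcal{F}_S\oplus\mathcal{V}_{PQ})$; matched composition $\mathcal{V}_{SP}\leftrightarrow\mathcal{V}_{PQ}=\{(f_S,g_Q):(f_S,h_P)\in\mathcal{V}_{SP},(h_P,g_Q)\in\mathcal{V}_{PQ}\text{ for some }h_P\}$. (So $\mathcal{V}_{WTV}\leftrightarrow\mathcal{V}_V$ is on $W\uplus T$, while $\mathcal{V}_{WTV}\cap\mathcal{V}_V$ and $\mathcal{V}_{WTV}+\mathcal{V}_V$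 are on $W\uplus T\uplus V$.) For pairwise disjoint $A,B,C$ (any possibly empty), a pair $\{\mathcal{V}_{AB},\mathcal{V}_{BC}\}$ of vector spaces on $A\uplus B$, $B\uplus C$ has the full sum property iff $\mathcal{V}_{AB}\circ B+\mathcal{V}_{BC}\circ B=\mathcal{F}_B$, the zero intersection property iff $(\mathcal{V}_{AB}\times B)\cap(\mathcal{V}_{BC}\times B)=\mathbf{0}_B$, and is rigid iff it has both properties (when $B=\emptyset$ it is taken to be rigid). *)

(* Defs.v *)
From HB Require Import structures.
From mathcomp Require Import all_boot all_order all_algebra.
From mathcomp Require Import finmap.

Set Implicit Arguments.
Unset Strict Implicit.
Unset Printing Implicit Defensive.

Import GRing.Theory.

Local Open Scope fset_scope.
Local Open Scope ring_scope.

(** All index sets are finite subsets [X : {fset K}] of one type [K] of labels,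
    so that vectors on different index sets are matched along common labels and
    the disjoint union of disjoint [X] and [Y] is simply [X `|` Y]. *)

Notation vec F X := {ffun X -> F^o}.

Section Spaces.

Variables (K : choiceType) (F : fieldType).
Implicit Types X Y Z : {fset K}.

(** [transfer Y f] agrees with [f] on [X `&` Y] and is [0] on [Y `\` X]: it is
    the restriction of [f] to [Y] when [Y `<=` X], and the extension of [f] to
    [Y] by zero when [X `<=` Y]. *)
Definition transfer X Y (f : vec F X) : vec F Y :=
  [ffun y : Y => oapp f 0 (insub (val y))].

Lemma transfer_is_linear X Y : linear (@transfer X Y).
Proof.
by move=> a f g; apply/ffunP=> y; rewrite !ffunE; case: insub => [x|] /=;
  rewrite ?ffunE // scaler0 addr0.
Qed.

HB.instance Definition _ X Y :=
  GRing.isLinear.Build F (vec F X) (vec F Y) *:%R (@transfer X Y)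
    (@transfer_is_linear X Y).

(** The space written V o Z, for [Z `<=` X]. *)
Definition restriction X (V : {vspace vec F X}) Z : {vspace vec F Z} :=
  (linfun (@transfer X Z) @: V)%VS.

(** The space written V x Z, for [Z `<=` X]. *)
Definition contraction X (V : {vspace vec F X}) Z : {vspace vec F Z} :=
  (linfun (@transfer Z X) @^-1: V)%VS.

(** For [X `<=` Y], with Q the set [Y `\` X]: [pad0 V Y] is V (+) 0_Q and
    [padF V Y] is V (+) F_Q, both as spaces on [Y]. The formulas are those of [restriction] and
    [contraction]; only the intended inclusion is reversed. *)
Definition pad0 X (V : {vspace vec F X}) Y : {vspace vec F Y} :=
  (linfun (@transfer X Y) @: V)%VS.

Definition padF X (V : {vspace vec F X}) Y : {vspace vec F Y} :=
  (linfun (@transfer Y X) @^-1: V)%VS.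

(** Meant for disjoint [X] and [Y]; the pair (f, g) is the vector on [X `|` Y]
    whose restrictions to [X] and [Y] are f and g. *)
Definition dsum X Y (VX : {vspace vec F X}) (VY : {vspace vec F Y}) :
    {vspace vec F (X `|` Y)} :=
  (padF VX (X `|` Y) :&: padF VY (X `|` Y))%VS.

(** In the following operations on a space on S + P and a space on P + Q, the
    three sets are [S = X `\` Y], [P = X `&` Y] and [Q = Y `\` X]. *)
Definition vsum X Y (VX : {vspace vec F X}) (VY : {vspace vec F Y}) :
    {vspace vec F (X `|` Y)} :=
  (pad0 VX (X `|` Y) + pad0 VY (X `|` Y))%VS.

Definition vcap X Y (VX : {vspace vec F X}) (VY : {vspace vec F Y}) :
    {vspace vec F (X `|` Y)} :=
  (padF VX (X `|` Y) :&: padF VY (X `|` Y))%VS.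

(** A vector (f_S, h_P, g_Q) with (f_S, h_P) in [VX] and (h_P, g_Q) in [VY] is
    a member of [vcap VX VY]; forgetting h_P gives the matched composition. See
    [mem_matched] for the description by elements. *)
Definition matched X Y (VX : {vspace vec F X}) (VY : {vspace vec F Y}) :
    {vspace vec F ((X `\` Y) `|` (Y `\` X))} :=
  restriction (vcap VX VY) ((X `\` Y) `|` (Y `\` X)).

(** For a pair of spaces on A + B and B + C, the common part B is [X `&` Y]. *)
Definition full_sum X Y (VX : {vspace vec F X}) (VY : {vspace vec F Y}) : Prop :=
  (restriction VX (X `&` Y) + restriction VY (X `&` Y))%VS = fullv.

Definition zero_intersection X Y
    (VX : {vspace vec F X}) (VY : {vspace vec F Y}) : Prop :=
  (contraction VX (X `&` Y) :&: contraction VY (X `&` Y))%VS = 0%VS.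

(** No separate clause is needed for an empty B: see [rigid_disjoint]. *)
Definition rigid X Y (VX : {vspace vec F X}) (VY : {vspace vec F Y}) : Prop :=
  full_sum VX VY /\ zero_intersection VX VY.

Lemma transferE X Y (f : vec F X) (x : X) (y : Y) :
  val x = val y -> transfer Y f y = f x.
Proof. by move=> xy; rewrite ffunE -xy valK. Qed.

Lemma transfer0 X Y (f : vec F X) (y : Y) :
  val y \notin X -> transfer Y f y = 0.
Proof. by move=> yX; rewrite ffunE insubN. Qed.

Lemma mem_restriction X (V : {vspace vec F X}) Z (g : vec F Z) :
  g \in restriction V Z <-> exists2 f, f \in V & g = transfer Z f.
Proof.
split=> [/memv_imgP[f fV ->]|[f fV ->]]; first by exists f; rewrite ?lfunE.
by apply/memv_imgP; exists f; rewrite ?lfunE.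
Qed.

Lemma mem_contraction X (V : {vspace vec F X}) Z (g : vec F Z) :
  (g \in contraction V Z) = (transfer X g \in V).
Proof. by rewrite -memv_preim lfunE. Qed.

Lemma mem_dsum X Y (VX : {vspace vec F X}) (VY : {vspace vec F Y}) h :
  (h \in dsum VX VY) = (transfer X h \in VX) && (transfer Y h \in VY).
Proof. by rewrite memv_cap -!memv_preim !lfunE. Qed.

Lemma mem_vcap X Y (VX : {vspace vec F X}) (VY : {vspace vec F Y}) h :
  (h \in vcap VX VY) = (transfer X h \in VX) && (transfer Y h \in VY).
Proof. by rewrite memv_cap -!memv_preim !lfunE. Qed.

Lemma mem_vsum X Y (VX : {vspace vec F X}) (VY : {vspace vec F Y}) h :
  h \in vsum VX VY <->
  exists f g, [/\ f \in VX, g \in VY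
                & h = transfer (X `|` Y) f + transfer (X `|` Y) g].
Proof.
split=> [/memv_addP[_ /memv_imgP[f fX ->] [_ /memv_imgP[g gY ->] ->]]|].
  by exists f, g; rewrite !lfunE.
move=> [f [g [fX gY ->]]]; apply/memv_addP.
exists (transfer (X `|` Y) f).
  by apply/memv_imgP; exists f; rewrite ?lfunE.
by exists (transfer (X `|` Y) g) => //; apply/memv_imgP; exists g; rewrite ?lfunE.
Qed.

Lemma mem_matched X Y (VX : {vspace vec F X}) (VY : {vspace vec F Y}) k :
  k \in matched VX VY <->
  exists f g, [/\ f \in VX, g \in VY,
    transfer (X `&` Y) f = transfer (X `&` Y) g,
    transfer (X `\` Y) k = transfer (X `\` Y) f
  & transfer (Y `\` X) k = transfer (Y `\` X) g].
Proof.
have tr (A B C : {fset K}) (f : vec F A) : (C `<=` B)%fset ->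
    transfer C (transfer B f) = transfer C f.
  move=> CB; apply/ffunP=> c; have cB := fsubsetP CB _ (valP c).
  by rewrite (@transferE _ _ _ [` cB] c) // !ffunE.
rewrite mem_restriction; split=> [[h]|[f [g [fX gY fg kf kg]]]].
  rewrite mem_vcap => /andP[hX hY] ->.
  exists (transfer X h), (transfer Y h); split=> //; rewrite !tr //.
  - exact: fsubsetIr.
  - exact: fsubsetIl.
  - exact: fsubsetDl.
  - exact: fsubsetUl.
  - exact: fsubsetDl.
  - exact: fsubsetUr.
pose h : vec F (X `|` Y) :=
  [ffun z => if insub (val z) is Some x then f x else oapp g 0 (insub (val z))].
have hX : transfer X h = f.
  apply/ffunP=> x; have xU : val x \in (X `|` Y) by rewrite inE (valP x).
  by rewrite (@transferE _ _ _ [` xU] x) // ffunE /= valK.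
have hY : transfer Y h = g.
  apply/ffunP=> y; have yU : val y \in (X `|` Y) by rewrite inE (valP y) orbT.
  rewrite (@transferE _ _ _ [` yU] y) // ffunE /= valK /=.
  case: insubP => // x _ xy.
  have yX : val y \in X := eq_ind _ (fun z => z \in X) (valP x) _ xy.
  have yI : val y \in (X `&` Y) by rewrite inE yX (valP y).
  have := congr1 (fun u : vec F _ => u [` yI]) fg.
  by rewrite /= (@transferE _ _ _ x) // (@transferE _ _ _ y).
exists h; first by rewrite mem_vcap hX hY fX gY.
apply/ffunP=> z; have := valP z; rewrite in_fsetU => /orP[zS|zQ].
- have zX : val z \in X by move: zS; rewrite inE => /andP[].
  have := congr1 (fun u : vec F _ => u [` zS]) kf.
  rewrite /= (@transferE _ _ _ z) // (@transferE _ _ _ [` zX]) // => ->.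
  by rewrite -hX !ffunE.
- have zY : val z \in Y by move: zQ; rewrite inE => /andP[].
  have := congr1 (fun u : vec F _ => u [` zQ]) kg.
  rewrite /= (@transferE _ _ _ z) // (@transferE _ _ _ [` zY]) // => ->.
  by rewrite -hY !ffunE.
Qed.

Lemma rigid_disjoint X Y (VX : {vspace vec F X}) (VY : {vspace vec F Y}) :
  [disjoint X & Y]%fset -> rigid VX VY.
Proof.
move=> dXY.
have eq_vec (f g : vec F (X `&` Y)) : f = g.
  apply/ffunP=> b; have := valP b; rewrite in_fsetI => /andP[bX].
  by rewrite (negPf (fdisjointP dXY _ bX)).
by split; apply/vspaceP=> f; rewrite (eq_vec f 0) !mem0v.
Qed.

End Spaces.

(* Main.v *)
Require Import Defs.
From mathcomp Require Import all_boot all_order all_algebra.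
From mathcomp Require Import finmap.

(** Everything happens inside the index set A of the large space [U], which
    contains the disjoint sets T and V. When the second index set is part of
    the first, both halves of rigidity are conditions on vectors
    ([full_sumP], [zero_intersectionP]), and each half of the rigidity of
    {U, VT (+) VV} splits into a condition on VV alone and a condition on VT
    relative to VV.

    - Full sum: every pair (t, v) is reached modulo VT (+) VV by some f in U.
      With t = 0 this is the full sum property of {U, VV}; with v = 0 it says
      that every t is reached modulo VT by some f in U whose V-part is in VV
      ([sum_relative]). Conversely, first correct v, then correct the remaining
      error on T by a vector which leaves the V-part unchanged modulo VV.
    - Zero intersection: (0, t, v) in U with t in VT and v in VV forces t = 0
      and v = 0. The conclusion t = 0 alone is [cap_relative]; once t = 0 is
      known, v = 0 is the zero intersection property of {U, VV}.

    The relative conditions forget how the V-part in VV was dealt with. So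
    [sum_relative] is the full sum property of VT with either the intersection
    or the matched composition of U and VV, and [cap_relative] is the zero
    intersection property of VT with either their sum or their matched
    composition. Finally the intersection lies inside the sum, because V is
    part of A, while the full sum property passes to larger spaces and the zero
    intersection property to smaller ones. Hence the two further conditions in
    the third equivalence follow from those in the second. *)

Set Implicit Arguments.
Unset Strict Implicit.

Import GRing.Theory.
Local Open Scope fset_scope.
Local Open Scope ring_scope.

(** * Transferring vectors between index sets *)

Section Transfer.

Variables (K : choiceType) (F : fieldType).
Implicit Types X Y Z : {fset K}.

(** A coordinate in X and Z survives a detour through Y exactly when it is also
    in Y. The hypothesis covers iterated restrictions (Z inside Y) as well as
    an extension followed by a restriction (X inside Y). *)
Lemma transfer_trans X Y Z (f : vec F X) :
  X `&` Z `<=` Y -> transfer Z (transfer Y f) = transfer Z f.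
Proof.
move=> XZY; apply/ffunP=> z; have [zX|zX] := boolP (val z \in X).
  have zY : val z \in Y by apply: (fsubsetP XZY); rewrite inE zX (valP z).
  by rewrite (@transferE _ _ _ _ _ [` zY] z) // !(@transferE _ _ _ _ _ [` zX]).
rewrite [RHS]transfer0 //; have [zY|zY] := boolP (val z \in Y).
  by rewrite (@transferE _ _ _ _ _ [` zY] z) // transfer0.
by rewrite transfer0.
Qed.

Lemma transfer_sub X Y Z (f : vec F X) :
  Z `<=` Y -> transfer Z (transfer Y f) = transfer Z f.
Proof.
by move=> ZY; rewrite transfer_trans // (fsubset_trans (fsubsetIr _ _)).
Qed.

Lemma transfer_id X (f : vec F X) : transfer X f = f.
Proof. by apply/ffunP=> x; rewrite (@transferE _ _ _ _ _ x x). Qed.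

Lemma transferK X Y (f : vec F X) :
  X `<=` Y -> transfer X (transfer Y f) = f.
Proof. by move=> XY; rewrite transfer_sub ?transfer_id. Qed.

Lemma transfer_disjoint X Y (f : vec F X) :
  [disjoint X & Y] -> transfer Y f = 0.
Proof.
move=> dXY; apply/ffunP=> y; rewrite transfer0 ?ffunE //.
by apply/negP=> yX; have := fdisjointP dXY _ yX; rewrite (valP y).
Qed.

Lemma eq_transferU X Y Z (f g : vec F X) : X `<=` Y `|` Z ->
  transfer Y f = transfer Y g -> transfer Z f = transfer Z g -> f = g.
Proof.
move=> XYZ eqY eqZ; apply/ffunP=> x.
have := fsubsetP XYZ _ (valP x); rewrite in_fsetU => /orP[xY|xZ].
  by have := congr1 (fun u : vec F _ => u [` xY]) eqY;
    rewrite /= !(@transferE _ _ _ _ _ x).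
by have := congr1 (fun u : vec F _ => u [` xZ]) eqZ;
  rewrite /= !(@transferE _ _ _ _ _ x).
Qed.

End Transfer.

(** * Rigidity when one index set contains the other *)

Section Nested.

Variables (K : choiceType) (F : fieldType).
Implicit Types X Y Z : {fset K}.

Lemma full_sumP X Y (VX : {vspace vec F X}) (VY : {vspace vec F Y}) :
  Y `<=` X ->
  full_sum VX VY <->
  forall g : vec F Y, exists2 f, f \in VX & g - transfer Y f \in VY.
Proof.
move=> /fsetIidPr YX; rewrite /full_sum YX; split=> [full g|reach].
  have /memv_addP[_ /mem_restriction[f fX ->]
    [_ /mem_restriction[h hY ->] ->]] :
    g \in (restriction VX Y + restriction VY Y)%VS by rewrite full memvf.
  by exists f => //; rewrite transfer_id addrC addKr.
apply/vspaceP=> g; rewrite memvf; have [f fX gf] := reach g.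
rewrite -[g](subrK (transfer Y f)) addrC; apply: memv_add.
  by apply/mem_restriction; exists f.
by apply/mem_restriction; exists (g - transfer Y f); rewrite // transfer_id.
Qed.

Lemma zero_intersectionP X Y (VX : {vspace vec F X}) (VY : {vspace vec F Y}) :
  Y `<=` X ->
  zero_intersection VX VY <->
  forall g : vec F Y, g \in VY -> transfer X g \in VX -> g = 0.
Proof.
move=> /fsetIidPr YX; rewrite /zero_intersection YX.
split=> [zero g gY gX|zero].
  apply/eqP; rewrite -memv0 -zero memv_cap !mem_contraction.
  by rewrite transfer_id gX gY.
apply/vspaceP=> g; rewrite memv_cap !mem_contraction transfer_id memv0.
apply/andP/eqP=> [[gX gY]|->]; first exact: zero.
by rewrite linear0 !mem0v.
Qed.

Lemma full_sum_restriction X Y Z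
    (VX : {vspace vec F X}) (VY : {vspace vec F Y}) :
  Y `<=` Z -> Z `<=` X ->
  full_sum (restriction VX Z) VY <-> full_sum VX VY.
Proof.
move=> YZ ZX; rewrite !full_sumP // ?(fsubset_trans YZ) //; split=> reach g.
  have [_ /mem_restriction[f fX ->]] := reach g.
  by rewrite transfer_sub //; exists f.
have [f fX gf] := reach g; exists (transfer Z f); last by rewrite transfer_sub.
by apply/mem_restriction; exists f.
Qed.

Lemma full_sum_subv X Y (VX VX' : {vspace vec F X}) (VY : {vspace vec F Y}) :
  Y `<=` X -> (VX <= VX')%VS -> full_sum VX VY -> full_sum VX' VY.
Proof.
move=> YX /subvP sub; rewrite !full_sumP // => reach g.
by have [f /sub fX gf] := reach g; exists f.
Qed.

Lemma zero_intersection_subv X Y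
    (VX VX' : {vspace vec F X}) (VY : {vspace vec F Y}) :
  Y `<=` X -> (VX <= VX')%VS ->
  zero_intersection VX' VY -> zero_intersection VX VY.
Proof.
move=> YX /subvP sub; rewrite !zero_intersectionP // => zero g gY /sub.
exact: zero.
Qed.

(** When Y is part of X, a vector of the intersection is already a vector of
    VX, so that its VY-summand can be taken to be 0. *)
Lemma vcap_sub_vsum X Y (VX : {vspace vec F X}) (VY : {vspace vec F Y}) :
  Y `<=` X -> (vcap VX VY <= vsum VX VY)%VS.
Proof.
move=> YX; apply/subvP=> h; rewrite mem_vcap mem_vsum => /andP[hX _].
exists (transfer X h), 0; split; rewrite ?mem0v // linear0 addr0.
by rewrite transfer_trans ?transfer_id // fsetIid fsubUset fsubset_refl.
Qed.

End Nested.

(** * Splitting rigidity along a direct sum *)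

Section Split.

Variables (K : choiceType) (F : fieldType) (A T V : {fset K}).
Hypotheses (TA : T `<=` A) (VA : V `<=` A) (dTV : [disjoint T & V]).
Variables (U : {vspace vec F A}) (VT : {vspace vec F T}) (VV : {vspace vec F V}).

(** The condition left on VT once VV has been dealt with, in a form that names
    neither the intersection nor the matched composition, which both express
    it. *)
Definition sum_relative : Prop := forall t : vec F T,
  exists f, [/\ f \in U, transfer V f \in VV & t - transfer T f \in VT].

(** The counterpart of [sum_relative] for zero intersection. Only t is required
    to vanish: that v does too is left to the pair {U, VV}. *)
Definition cap_relative : Prop := forall (t : vec F T) (v : vec F V),
  t \in VT -> v \in VV -> transfer A t + transfer A v \in U -> t = 0.

(** The index set of the matched composition, in the form that [matched] gives
    to A minus V. *)
Let S := (A `\` V) `|` (V `\` A).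

Let dVT : [disjoint V & T]. Proof. by rewrite fdisjoint_sym. Qed.
Let TVA : T `|` V `<=` A. Proof. by rewrite fsubUset TA VA. Qed.
Let TAV : T `<=` A `|` V. Proof. by rewrite fsubsetU ?TA. Qed.
Let AAV : A `<=` A `|` V. Proof. exact: fsubsetUl. Qed.
Let AVA : A `|` V `<=` A. Proof. by rewrite fsubUset fsubset_refl VA. Qed.
Let TS : T `<=` S.
Proof.
apply/fsubsetP=> x xT; rewrite !inE (fsubsetP TA _ xT).
by rewrite (negPf (fdisjointP dTV _ xT)).
Qed.
Let SAV : S `<=` A `|` V.
Proof.
by apply/fsubsetP=> x; rewrite !inE => /orP[] /andP[_ ->]; rewrite ?orbT.
Qed.
Let SA : S `<=` A. Proof. exact: fsubset_trans SAV AVA. Qed.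
Let dVS : [disjoint V & S].
Proof. by apply/fdisjointP=> x xV; rewrite !inE xV (fsubsetP VA). Qed.

Let pair_vec (t : vec F T) (v : vec F V) : vec F (T `|` V) :=
  transfer (T `|` V) t + transfer (T `|` V) v.

Let pair_vecT t v : transfer T (pair_vec t v) = t.
Proof.
rewrite linearD /= transferK ?fsubsetUl // transfer_sub ?fsubsetUl //.
by rewrite transfer_disjoint // addr0.
Qed.

Let pair_vecV t v : transfer V (pair_vec t v) = v.
Proof.
rewrite linearD /= [X in _ + X]transferK ?fsubsetUr //.
by rewrite transfer_sub ?fsubsetUr // transfer_disjoint // add0r.
Qed.

(** The backward direction is a two-step correction: f settles the V-part, and
    the relative condition settles what is left on T with a vector g whose
    V-part is in VV, so that the V-part of f + g is still right. *)
Lemma full_sum_dsum :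
  full_sum U (dsum VT VV) <-> full_sum U VV /\ sum_relative.
Proof.
rewrite !full_sumP //; split=> [reach|[reachV reachT] h].
  split=> [v|t].
    have [f fU] := reach (pair_vec 0 v).
    rewrite mem_dsum !linearB /= (transfer_sub _ (fsubsetUr T V)) pair_vecV.
    by case/andP=> _ vf; exists f.
  have [f fU] := reach (pair_vec t 0).
  rewrite mem_dsum !linearB /= (transfer_sub _ (fsubsetUl T V)).
  rewrite (transfer_sub _ (fsubsetUr T V)) pair_vecT pair_vecV sub0r memvN.
  by case/andP=> tf vf; exists f.
have [f fU hf] := reachV (transfer V h).
have [g [gU gV hg]] := reachT (transfer T h - transfer T f).
exists (f + g); first exact: memvD.
rewrite mem_dsum !linearB /= (transfer_sub _ (fsubsetUl T V)).
rewrite (transfer_sub _ (fsubsetUr T V)) !linearD /=.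
by rewrite !addrA hg memvB.
Qed.

Lemma zero_intersection_dsum :
  zero_intersection U (dsum VT VV) <-> zero_intersection U VV /\ cap_relative.
Proof.
rewrite !zero_intersectionP //.
have pairA t v : transfer A (pair_vec t v) = transfer A t + transfer A v.
  rewrite linearD /= !transfer_trans //.
    exact: fsubset_trans (fsubsetIl _ _) (fsubsetUr _ _).
  exact: fsubset_trans (fsubsetIl _ _) (fsubsetUl _ _).
have pairE h : h = pair_vec (transfer T h) (transfer V h).
  by apply: (@eq_transferU _ _ _ T V); rewrite ?pair_vecT ?pair_vecV.
split=> [zero|[zeroV zeroT] h].
  have zero_pair t v : t \in VT -> v \in VV ->
      transfer A t + transfer A v \in U -> pair_vec t v = 0.
    move=> tT vV tvU; apply: zero; last by rewrite pairA.
    by rewrite mem_dsum pair_vecT pair_vecV tT.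
  split=> [v vV vU|t v tT vV tvU].
    rewrite -(pair_vecV 0 v) zero_pair ?linear0 ?mem0v //.
    by rewrite add0r.
  by rewrite -(pair_vecT t v) zero_pair // linear0.
rewrite mem_dsum {3}(pairE h) pairA => /andP[hT hV] hU.
have t0 := zeroT _ _ hT hV hU; move: hU; rewrite t0 linear0 add0r => hU.
by rewrite (pairE h) t0 (zeroV _ hV hU) /pair_vec !linear0 addr0.
Qed.

Lemma full_sum_vcap : full_sum (vcap U VV) VT <-> sum_relative.
Proof.
rewrite full_sumP //; split=> [reach t|reach t].
  have [h] := reach t; rewrite mem_vcap => /andP[hA hV] th.
  by exists (transfer A h); rewrite transfer_sub // transfer_sub.
have [f [fU fV tf]] := reach t; exists (transfer (A `|` V) f).
  by rewrite mem_vcap transferK ?fsubsetUl // transfer_sub ?fsubsetUr // fU.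
by rewrite transfer_sub.
Qed.

(** The matched composition is the restriction of the intersection to the labels
    outside V, and only the T-part of a vector matters for the full sum. *)
Lemma full_sum_matched : full_sum (matched U VV) VT <-> sum_relative.
Proof. by rewrite full_sum_restriction ?full_sum_vcap. Qed.

(** A vector (0, t, 0) is in the sum exactly when subtracting its VV-summand
    gives a vector of U, whence the change of sign of the V-part. *)
Lemma zero_intersection_vsum :
  zero_intersection (vsum U VV) VT <-> cap_relative.
Proof.
rewrite zero_intersectionP //; split=> [zero t v tT vV tvU|zero t tT].
  apply: zero => //; apply/mem_vsum.
  exists (transfer A t + transfer A v), (- v); split; rewrite ?memvN //.
  by rewrite linearN linearD /= !(transfer_sub _ AVA) addrK.
move=> /mem_vsum[f [g [fU gV eqt]]]; apply: (zero t (- g)); rewrite ?memvN //.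
have := congr1 (transfer A) eqt.
rewrite linearD /= !(transfer_sub _ AAV) transfer_id linearN /= => ->.
by rewrite addrK.
Qed.

(** A member of the intersection whose S-part is that of t is, seen on A, the
    vector t plus its own V-part, since S and V together cover A. *)
Lemma zero_intersection_matched :
  zero_intersection (matched U VV) VT <-> cap_relative.
Proof.
rewrite zero_intersectionP //; split=> [zero t v tT vV tvU|zero t tT].
  apply: zero => //; apply/mem_restriction.
  exists (transfer (A `|` V) (transfer A t + transfer A v)).
    rewrite mem_vcap transferK ?fsubsetUl // tvU.
    rewrite transfer_sub ?fsubsetUr // linearD /= !transfer_sub //.
    by rewrite transfer_disjoint // add0r transfer_id.
  rewrite -/S (transfer_sub _ SAV) linearD /= !(transfer_sub _ SA).
  by rewrite [X in _ + X]transfer_disjoint // addr0.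
move=> /mem_restriction[h]; rewrite mem_vcap => /andP[hA hV] eqS.
apply: (zero t (transfer V h)) => //.
suff <- : transfer A h = transfer A t + transfer A (transfer V h) by [].
apply: (@eq_transferU _ _ _ S V); rewrite ?linearD /=.
- by apply/fsubsetP=> x xA; rewrite !inE xA; case: (x \in V).
- by rewrite !(transfer_sub _ SA) [X in _ + X]transfer_disjoint // addr0.
- by rewrite !transfer_sub // (transfer_disjoint t) // add0r.
Qed.

Lemma rigid_dsum : rigid U (dsum VT VV) <->
  rigid U VV /\ sum_relative /\ cap_relative.
Proof.
rewrite /rigid full_sum_dsum zero_intersection_dsum.
by split=> [[[? ?] [? ?]]|[[? ?] [? ?]]].
Qed.

End Split.

Theorem theorem21 (K : choiceType) (F : fieldType) (W T V : {fset K})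
  (dWT : [disjoint W & T]%fset)
  (dWV : [disjoint W & V]%fset)
  (dTV : [disjoint T & V]%fset)
  (VWTV : {vspace vec F (W `|` T `|` V)%fset})
  (VV : {vspace vec F V})
  (VT : {vspace vec F T}) :
  [/\ rigid VWTV (dsum VT VV) <->
        rigid VWTV VV /\ rigid (matched VWTV VV) VT,
      rigid VWTV (dsum VT VV) <->
        [/\ rigid VWTV VV,
            full_sum (vcap VWTV VV) VT
          & zero_intersection (vsum VWTV VV) VT]
    & rigid VWTV (dsum VT VV) <->
        [/\ rigid VWTV VV,
            rigid (vcap VWTV VV) VT
          & rigid (vsum VWTV VV) VT]].
Proof.
have VA : V `<=` W `|` T `|` V by exact: fsubsetUr.
have TA : T `<=` W `|` T `|` V by apply/fsubsetU; rewrite fsubsetUr.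
have TAV : T `<=` (W `|` T `|` V) `|` V by apply/fsubsetU; rewrite TA.
have second : rigid VWTV (dsum VT VV) <->
    [/\ rigid VWTV VV, full_sum (vcap VWTV VV) VT
      & zero_intersection (vsum VWTV VV) VT].
  rewrite rigid_dsum // -full_sum_vcap // -zero_intersection_vsum //.
  by split=> [[? [? ?]]|[? ? ?]].
split=> //.
  by rewrite rigid_dsum // -full_sum_matched // -zero_intersection_matched.
have capsum := vcap_sub_vsum VWTV VV VA.
rewrite second; split=> [[rV fs zi]|[rV [fs _] [_ zi]]]; last by [].
split=> //; split=> //.
  exact: zero_intersection_subv capsum zi.
exact: full_sum_subv capsum fs.
Qed.
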